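(* Let $A$ be a non-zero positive bounded operator on a complex Hilbert space $\mathscr{H}$ and let $T\in\mathbb{B}_A(\mathscr{H})$. Then for every non-zero scalar $\alpha\in\mathbb{C}$, $$w_A^2(T)\le\frac{\max\{1,|1-\alpha|\}\,\|T\|_A^2+w_A(T^2)}{|\alpha|}.$$
   Context: $\mathbb{B}(\mathscr{H})$ is the algebra of bounded linear operators on $\mathscr{H}$. For $x,y\in\mathscr{H}$, $\langle x,y\rangle_A=\langle Ax,y\rangle$ and $\|x\|_A=\langle Ax,x\rangle^{1/2}$. $\mathbb{B}_A(\mathscr{H})$ is the set of $T\in\mathbb{B}(\mathscr{H})$ for which there is $S\in\mathbb{B}(\mathscr{H})$ with $AS=T^*A$. The $A$-operator seminorm is $\|T\|_A=\sup\{\|Tx\|_A:\|x\|_A=1\}$ (finite for $T\in\mathbb{B}_A(\mathscr{H})$), and the $A$-numerical radius is $w_A(T)=\sup\{|\langle Tx,x\rangle_A|:\|x\|_A=1\}$; $w_A^2(T)$ means $(w_A(T))^2$. *)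

(* Defs.v *)
From mathcomp Require Import all_boot all_order all_algebra.
From mathcomp Require Import all_classical all_reals all_analysis.
From mathcomp Require Export complex.

Set Implicit Arguments.
Unset Strict Implicit.
Unset Printing Implicit Defensive.

Import Order.TTheory GRing.Theory Num.Theory.
Import numFieldNormedType.Exports.

Local Open Scope classical_set_scope.
Local Open Scope complex_scope.
Local Open Scope ring_scope.

Section SemiHilbert.
Context {R : realType} {H : completeNormedModType R[i]}.
Variable ip : {dot H for (@Num.conj R[i])}.

(* The inner product [ip x y], linear in [x] and conjugate-linear in [y],
   induces the complete norm of [H], so that [H] is a complex Hilbert space. *)
Definition hilbert_norm : Prop := forall x : H, ip x x = `|x| ^+ 2.

Definition bounded_op (T : {linear H -> H}) : Prop :=
  bounded_near T (nbhs (0 : H)).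

(* The order of [R[i]] compares only numbers with equal imaginary parts: the
   inequality says that <Ax, x> is real and nonnegative. *)
Definition positive_op (A : {linear H -> H}) : Prop :=
  forall x : H, 0 <= ip (A x) x.

(* [adjoint T y] is the vector [z] with <Tx, y> = <x, z> for every [x]. It is
   unique, and exists for bounded [T] by the Riesz representation theorem; the
   default value 0 is then never used. *)
Definition adjoint (T : {linear H -> H}) (y : H) : H :=
  xget 0 [set z : H | forall x : H, ip (T x) y = ip x z].

Variable A : {linear H -> H}.

Definition ipA (x y : H) : R[i] := ip (A x) y.

(* For positive [A], [ipA x x] is real, so that [Re] only changes its type. *)
Definition normA (x : H) : R := Num.sqrt (complex.Re (ipA x x)).

Definition in_BA (T : {linear H -> H}) : Prop :=
  bounded_op T /\
  exists S : {linear H -> H},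
    bounded_op S /\ forall x : H, A (S x) = adjoint T (A x).

Definition opnormA (T : H -> H) : R :=
  sup [set normA (T x) | x in [set x : H | normA x = 1]].

Definition numradA (T : H -> H) : R :=
  sup [set Normc.normc (ipA (T x) x) | x in [set x : H | normA x = 1]].

End SemiHilbert.

(* Main.v *)
(** Write [f x y] for the semi-inner product <Ax, y> and [S] for an [A]-adjoint
    of [T]. For a unit vector [e], splitting [x] and [y] along [e] gives the
    Buzano type inequality
      |alpha| |f x e| |f e y| <= max(1, |1 - alpha|) |x|_A |y|_A + |f x y|.
    Taking [Tx], [e], [Se] for [x], [e], [y], the left side becomes
    |alpha| |<Te, e>_A|^2, the last term |<T^2 e, e>_A|, and |Se|_A <= |T|_A.
    The suprema are finite because [ST] is [A]-selfadjoint and norm bounded: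
    |STx|_A <= |ST| whenever |x|_A = 1, by iterating Cauchy-Schwarz. *)

Require Import Defs.
From HB Require Import structures.
From mathcomp Require Import all_boot all_order all_algebra.
From mathcomp Require Import all_classical all_reals all_analysis.
From mathcomp Require Import ring lra.

Import Order.TTheory GRing.Theory Num.Theory.
Import numFieldNormedType.Exports.

Local Open Scope complex_scope.
Local Open Scope ring_scope.

Import Normc.

(** * Complex modulus, and two auxiliary facts on real numbers *)

Section Complex.
Context {R : rcfType}.
Implicit Types z : R[i].

Lemma normc_ge0 z : 0 <= normc z.
Proof. by case: z => a b; apply: sqrtr_ge0. Qed.

Lemma sqr_normc_ReIm z : normc z ^+ 2 = complex.Re z ^+ 2 + complex.Im z ^+ 2.
Proof. by case: z => a b; rewrite /= sqr_sqrtr// addr_ge0 ?sqr_ge0. Qed.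

Lemma normc_real (r : R) : normc r%:C = `|r|.
Proof. by rewrite /= expr0n addr0 sqrtr_sqr. Qed.

End Complex.

(** A discriminant argument, used below with [n] a squared modulus and [b] a seminorm; allowing
    [b = 0] spares the degenerate case there. *)
Lemma quadratic_ge0 (R : realFieldType) (a b n : R) : 0 <= n ->
  (forall s, 0 <= a - 2 * s * n + s ^+ 2 * n * b ^+ 2) -> n <= a * b ^+ 2.
Proof.
move=> n0 H; have [b0|b0] := eqVneq b 0.
  rewrite b0 expr0n mulr0 leNgt; apply/negP => np.
  (* This [s] makes the affine function [a - 2 * s * n] equal to -1. *)
  have := H ((a + 1) / (2 * n)); rewrite b0 expr0n mulr0 addr0.
  rewrite -mulrA (mulrC _ n) mulrA.
  have -> : 2 * n * ((a + 1) / (2 * n)) = a + 1.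
    by rewrite mulrC divfK// mulf_neq0// gt_eqF.
  lra.
have b2 : 0 < b ^+ 2 by rewrite exprn_even_gt0.
(* The vertex of the parabola in [s]. *)
have := H (b ^+ 2)^-1.
have -> : a - 2 * (b ^+ 2)^-1 * n + (b ^+ 2)^-1 ^+ 2 * n * b ^+ 2
  = (a * b ^+ 2 - n) / b ^+ 2 by field.
by rewrite pmulr_lge0 ?invr_gt0// subr_ge0.
Qed.

Lemma expr_unbounded (R : realType) (r K : R) : 1 < r -> exists n, K < r ^+ n.
Proof.
move=> r1; pose n := Num.bound `|K / (r - 1)|.
have r0 : 0 < r - 1 by rewrite subr_gt0.
have bern k : 1 + k%:R * (r - 1) <= r ^+ k.
  elim: k => [|k IH]; first by rewrite mul0r addr0 expr0.
  rewrite exprS; apply: (@le_trans _ _ (r * (1 + k%:R * (r - 1)))).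
    rewrite -natr1; have : 0 <= k%:R * (r - 1) ^+ 2 by rewrite mulr_ge0 ?sqr_ge0.
    lra.
  by rewrite ler_wpM2l//; lra.
exists n; apply: lt_le_trans (bern n).
have : K / (r - 1) < n%:R.
  by apply: le_lt_trans (ler_norm _) (archi_boundP _).
by rewrite ltr_pdivrMr//; lra.
Qed.

(** * Semidefinite Hermitian forms: Cauchy-Schwarz and the Buzano type inequality *)

Section Semidefinite.
Context {R : rcfType} {V : lmodType R[i]}.
Variable f : {bilinear V -> V -> R[i] | *%R & Num.conj \; *%R}.
Variable f_ge0 : forall x, 0 <= f x x.

(** Kept general to serve both [ip] and [ipA ip A]; [normA ip A] is convertible to
    [seminorm (ipA ip A)]. *)
Definition seminorm (x : V) : R := Num.sqrt (complex.Re (f x x)).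

Let N := seminorm.

Lemma formZl a x y : f (a *: x) y = a * f x y.
Proof. exact: linearZl_LR. Qed.

Lemma formZr a x y : f x (a *: y) = Num.conj a * f x y.
Proof. exact: linearZr_LR. Qed.

Lemma formDZ (a : R[i]) x y : f (x + a *: y) (x + a *: y) =
  f x x + Num.conj a * f x y + a * f y x + a * Num.conj a * f y y.
Proof.
rewrite linearDr !linearDl !(formZl, formZr); ring.
Qed.

(* Polarisation: [f] is real on [x + y] and on [x + i y]. *)
Lemma formC x y : f y x = Num.conj (f x y).
Proof.
have := f_ge0 (x + 1 *: y); have := f_ge0 (x + 'i *: y).
rewrite !formDZ.
have := f_ge0 x; have := f_ge0 y.
case: (f x x) => x1 x2; case: (f y y) => y1 y2.
case: (f x y) => a b; case: (f y x) => c d; rewrite !lecE /=.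
move=> /andP[/eqP ? _] /andP[/eqP ? _] /andP[/eqP h1 _] /andP[/eqP h2 _].
apply/eqP; rewrite eq_complex/=; apply/andP; split; apply/eqP; lra.
Qed.

Lemma seminorm_ge0 x : 0 <= N x.
Proof. exact: sqrtr_ge0. Qed.

Lemma form_seminorm x : f x x = (N x ^+ 2)%:C.
Proof.
rewrite /N /seminorm; have := f_ge0 x; case: (f x x) => a b; rewrite lecE/=.
by move=> /andP[/eqP -> a0]; rewrite sqr_sqrtr.
Qed.

Lemma sqr_seminorm x : N x ^+ 2 = normc (f x x).
Proof. by rewrite form_seminorm normc_real ger0_norm ?sqr_ge0. Qed.

Lemma seminormDZ (a : R[i]) x y : N (x + a *: y) ^+ 2 =
  N x ^+ 2 + (complex.Re (Num.conj a * f x y)) *+ 2 + normc a ^+ 2 * N y ^+ 2.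
Proof.
apply: complexI; rewrite -form_seminorm formDZ (formC x y) !form_seminorm.
rewrite sqr_normc_ReIm.
case: a => a b; case: (f x y) => c d.
by apply/eqP; rewrite eq_complex/=; apply/andP; split; apply/eqP; ring.
Qed.

Lemma seminormZ a x : N (a *: x) = normc a * N x.
Proof.
apply/eqP; rewrite -(@eqrXn2 _ 2) ?seminorm_ge0 ?mulr_ge0 ?normc_ge0 ?seminorm_ge0//.
have := seminormDZ a 0 x; rewrite add0r linear0l mulr0 /= mul0rn => ->.
by rewrite /N /seminorm linear0l/= sqrtr0 expr0n/= !add0r exprMn.
Qed.

Lemma cauchy_schwarz x y : normc (f x y) <= N x * N y.
Proof.
rewrite -(@ler_sqr _ (normc _)) ?nnegrE ?mulr_ge0 ?normc_ge0 ?seminorm_ge0// exprMn.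
set n := normc (f x y) ^+ 2.
(* Expanding the squared seminorm of x - s (f x y) y gives this quadratic in [s]. *)
have H (s : R) : 0 <= N x ^+ 2 - 2 * s * n + s ^+ 2 * n * N y ^+ 2.
  apply: le_trans (sqr_ge0 (N (x + (- (s%:C * f x y)) *: y))) _.
  rewrite seminormDZ /n !sqr_normc_ReIm; case: (f x y) => a b /=.
  lra.
apply: quadratic_ge0 H; exact: sqr_ge0.
Qed.

Lemma buzano (alpha : R[i]) e x y : N e = 1 ->
  normc alpha * (normc (f x e) * normc (f e y)) <=
  Num.max 1 (normc (1 - alpha)) * (N x * N y) + normc (f x y).
Proof.
move=> Ne; set m := Num.max _ _.
have [m1 ma] : 1 <= m /\ normc (1 - alpha) <= m by split; rewrite le_max lexx ?orbT.
have m0 : 0 <= m by exact: le_trans m1.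
(* The vectors [x'] and [y'] below are the parts of [x] and [y] orthogonal to [e]; Pythagoras gives
   their seminorms. *)
set a := f x e; set b := f e y.
have fye : f y e = Num.conj b by rewrite formC.
pose x' := x + (- a) *: e; pose y' := y + (- Num.conj b) *: e.
have Nx' : N x' ^+ 2 = N x ^+ 2 - normc a ^+ 2.
  rewrite seminormDZ Ne /a !sqr_normc_ReIm; case: (f x e) => a1 a2 /=; ring.
have Ny' : N y' ^+ 2 = N y ^+ 2 - normc b ^+ 2.
  rewrite seminormDZ Ne fye /b !sqr_normc_ReIm; case: (f e y) => b1 b2 /=; ring.
have fx'y' : f x' y' = f x y - a * b.
  rewrite /x' /y' linearDr !linearDl !(formZl, formZr) -/a -/b.
  have -> : Num.conj (- Num.conj b) = - b.
    by rewrite rmorphN; congr (- _); exact: conjCK.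
  rewrite (form_seminorm e) Ne expr1n; ring.
rewrite -!normcM.
(* Writing alpha as 1 - (1 - alpha) lets one copy of a b be replaced by f x y - f x' y'. *)
have -> : alpha * (a * b) = f x y - (f x' y' + (1 - alpha) * (a * b)).
  by rewrite fx'y'; ring.
apply: le_trans (le_normcD _ _) _; rewrite addrC lerD2r normcN.
apply: le_trans (le_normcD _ _) _; rewrite !normcM.
have ab0 : 0 <= normc a * normc b by rewrite mulr_ge0 ?normc_ge0.
have NN0 : 0 <= N x' * N y' by rewrite mulr_ge0 ?seminorm_ge0.
apply: (@le_trans _ _ (m * (N x' * N y' + normc a * normc b))).
  rewrite mulrDr; apply: lerD; last exact: ler_wpM2r.
  by apply: le_trans (cauchy_schwarz _ _) _; rewrite -{1}(mul1r (N x' * _)) ler_wpM2r.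
rewrite ler_wpM2l// -ler_sqr ?nnegrE ?addr_ge0 ?mulr_ge0 ?seminorm_ge0 ?normc_ge0//.
(* Cauchy-Schwarz in the plane for (N x', |a|) and (N y', |b|), by Lagrange's identity. *)
have : 0 <= (N x' * normc b - N y' * normc a) ^+ 2 by exact: sqr_ge0.
rewrite [(N x * N y) ^+ 2]exprMn.
have -> : N x ^+ 2 = N x' ^+ 2 + normc a ^+ 2 by rewrite Nx' subrK.
have -> : N y ^+ 2 = N y' ^+ 2 + normc b ^+ 2 by rewrite Ny' subrK.
lra.
Qed.

End Semidefinite.

(** * Operators adjoint with respect to a semidefinite form *)

Section SemidefiniteReal.
Context {R : realType} {V : lmodType R[i]}.
Variable f : {bilinear V -> V -> R[i] | *%R & Num.conj \; *%R}.
Variable f_ge0 : forall x, 0 <= f x x.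

Let N := seminorm f.

(* [N (Q x) ^ 2^n <= N (Q^(2^n) x) <= K M^(2^n)] by repeated squaring, and
   letting n grow removes the constant [K]. *)
Lemma selfadjoint_seminorm_le (Q : V -> V) (K M : R) x :
  (forall u v, f (Q u) v = f u (Q v)) -> 0 < M -> N x = 1 ->
  (forall n, N (iter n Q x) <= K * M ^+ n) -> N (Q x) <= M.
Proof.
move=> Qsa M0 Nx Qn; rewrite leNgt; apply/negP => MQ.
have iter_sa n u v : f (iter n Q u) v = f u (iter n Q v).
  by elim: n u v => //= n IH u v; rewrite Qsa IH -iterSr.
have N_double n : N (iter n Q x) ^+ 2 <= N (iter (n * 2) Q x).
  rewrite sqr_seminorm// iter_sa -iterD addnn -muln2.
  by apply: le_trans (cauchy_schwarz _ f_ge0 _ _) _; rewrite -/N Nx mul1r.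
have N_pow n : N (Q x) ^+ (2 ^ n) <= N (iter (2 ^ n) Q x).
  elim: n => [//|n IH]; rewrite expnSr exprM; apply: le_trans (N_double _).
  by rewrite ler_sqr// nnegrE ?exprn_ge0 ?seminorm_ge0.
have r1 : 1 < N (Q x) / M by rewrite ltr_pdivlMr// mul1r.
have [n] := expr_unbounded _ _ K r1.
apply/negP; rewrite -leNgt.
(* Powers are controlled only at exponents [2 ^ n], so [n] is first raised to [2 ^ n]. *)
apply: (@le_trans _ _ ((N (Q x) / M) ^+ (2 ^ n))).
  apply: ler_weXn2l; first by rewrite ler_pdivlMr// mul1r ltW.
  by apply/ltnW/ltn_expl.
rewrite expr_div_n ler_pdivrMr ?exprn_gt0//.
exact: le_trans (N_pow n) (Qn _).
Qed.

(** N (S x)^2 = |f (T (S x)) x| <= c N (S x) N x, and N (S x) cancels unless it is 0; in that case c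
    N x >= N (T x) >= 0 suffices. *)
Lemma adjoint_seminorm_le (T S : V -> V) (c : R) x :
  (forall u v, f (T u) v = f u (S v)) -> (forall u, N (T u) <= c * N u) ->
  N (S x) <= c * N x.
Proof.
move=> TS Tc; have [Sx0|Sx0] := eqVneq (N (S x)) 0.
  rewrite Sx0; exact: le_trans (seminorm_ge0 _ _) (Tc x).
have Sx_gt0 : 0 < N (S x) by rewrite lt_def Sx0 seminorm_ge0.
rewrite -(ler_pM2l Sx_gt0) -expr2.
rewrite sqr_seminorm// -TS.
apply: le_trans (cauchy_schwarz _ f_ge0 _ _) _; rewrite mulrA.
by rewrite ler_wpM2r ?seminorm_ge0// mulrC Tc.
Qed.

End SemidefiniteReal.

(** * Hilbert space: Riesz representation and adjoints *)

Section Hilbert.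
Local Open Scope classical_set_scope.
Local Open Scope ring_scope.
Context {R : realType} {H : completeNormedModType R[i]}.
Variable ip : {dot H for (@Num.conj R[i])}.
Variable ipN : hilbert_norm ip.

Let N := seminorm ip.

Lemma ip_ge0 x : 0 <= ip x x.
Proof. by rewrite ipN exprn_ge0. Qed.

Lemma norm_seminorm x : `|x| = (N x)%:C.
Proof.
apply/eqP; rewrite -(@eqrXn2 _ 2)// ?ler0c ?seminorm_ge0//.
by rewrite -ipN form_seminorm ?rmorphXn//; exact: ip_ge0.
Qed.

Lemma bounded_op_seminorm (T : {linear H -> H}) : bounded_op T ->
  exists2 M, 0 < M & forall x, N (T x) <= M * N x.
Proof.
move=> /linear_boundedP /pinfty_ex_gt0[[M M'] M0 TM].
move: M0; rewrite ltcE/= => /andP[/eqP M'0 M0]; exists M => // x.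
by have := TM x; rewrite M'0 !norm_seminorm lecE/= !mul0r subr0 => /andP[].
Qed.

(* If [x] minimises J x = |x|^2 - 2 Re (g x) up to [e^2], then the first
   variation <x, h> - (g h)^* is at most [e |h|]. Hence near-minimisers form a
   Cauchy filter, and the variation vanishes at its limit. *)
Lemma riesz (g : {scalar H}) (M : R) :
  (forall x, normc (g x) <= M * N x) -> exists z, forall x, g x = ip x z.
Proof.
move=> gM.
have gDZ a u v : g (u + a *: v) = g u + a * g v by rewrite addrC linearP addrC.
pose J x := N x ^+ 2 - 2 * complex.Re (g x).
pose E := [set J x | x in [set: H]].
have infE : has_inf E.
  split; first by exists (J 0), 0.
  (* Completing the square: |x|^2 - 2 M |x| >= - M^2. *)
  exists (- M ^+ 2) => _ [x _ <-]; rewrite /J.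
  have := gM x; have : complex.Re (g x) <= normc (g x).
    case: (g x) => a b /=; apply: le_trans (ler_norm _) _.
    by rewrite -sqrtr_sqr ler_wsqrtr// lerDl sqr_ge0.
  have := sqr_ge0 (N x - M); lra.
pose P (e : R) := [set x | forall h, normc (ip x h - Num.conj (g h)) <= e * N h].
have P_neq0 e : 0 < e -> P e !=set0.
  move=> e0; have [|_ [x _ <-] Jx] := @inf_adherent _ E (e ^+ 2) _ infE.
    by rewrite exprn_gt0.
  exists x => h.
  rewrite -ler_sqr ?nnegrE ?normc_ge0 ?mulr_ge0 ?seminorm_ge0 ?(ltW e0)// exprMn.
  set w := ip x h - _; apply: quadratic_ge0; first exact: sqr_ge0.
  (* This move changes J by - 2 s |w|^2 + s^2 |w|^2 |h|^2, and near-minimality bounds any decrease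
     by e^2. *)
  move=> s; have : inf E <= J (x + (- (s%:C * w)) *: h).
    by apply: inf_lbound; [case: infE | exists (x + (- (s%:C * w)) *: h)].
  rewrite /J seminormDZ; last exact: ip_ge0.
  move: Jx; rewrite /J.
  rewrite gDZ !sqr_normc_ReIm /= /w.
  case: (ip x h) => a b; case: (g h) => c d; case: (g x) => j k /=.
  rewrite -/N; lra.
pose F := filter_from [set e : R | 0 < e] P.
have FF : ProperFilter F.
  apply: filter_from_proper; last by move=> e /P_neq0.
  apply: filter_from_filter; first by exists 1; rewrite /= ltr01.
  move=> e1 e2 /= e10 e20; exists (Num.min e1 e2); first by rewrite /= lt_min e10.
  move=> x Px; split => h; apply: le_trans (Px h) _; rewrite ler_wpM2r ?seminorm_ge0//.
  - by rewrite ge_min lexx.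
  - by rewrite ge_min lexx orbT.
have Pball e x y : 0 < e -> P e x -> P e y -> N (x - y) <= 2 * e.
  move=> e0 Px Py; have [->|xy0] := eqVneq (N (x - y)) 0; first by rewrite mulr_ge0 ?ltW.
  have xy_gt0 : 0 < N (x - y) by rewrite lt_def xy0 seminorm_ge0.
  rewrite -(ler_pM2r xy_gt0) -expr2.
  have -> : N (x - y) ^+ 2 = normc (ip (x - y) (x - y)).
    exact: (sqr_seminorm ip ip_ge0).
  (* Both variations are tested on [h = x - y] itself: the terms in [g h] cancel, leaving |h|^2 <= 2
     e |h|. *)
  set h := x - y; have := lerD (Px h) (Py h).
  have -> : ip h h = ip x h - Num.conj (g h) - (ip y h - Num.conj (g h)).
    by rewrite {1}/h linearBl; ring.
  move=> le2; apply: le_trans (le_normcD _ _) _; rewrite normcN; lra.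
have /cvg_ex[z Fz] : cvg F.
  apply: cauchy_cvg; apply: cauchy_exP => -[e e']; rewrite ltcE/= => /andP[/eqP -> e0].
  have e4 : 0 < e / 4 by rewrite divr_gt0.
  have [x Px] := P_neq0 _ e4; exists x; exists (e / 4) => // y Py.
  rewrite -ball_normE /= norm_seminorm ltcR.
  by apply: le_lt_trans (Pball _ _ _ e4 Px Py) _; lra.
exists z => x.
have Nz e : 0 < e -> normc (ip z x - Num.conj (g x)) <= 2 * e * N x.
  move=> e0.
  have : F [set y | `|z - y| < e%:C] by move/fcvgrPdist_lt: Fz; apply; rewrite ltcR.
  have FP : F (P e) by exists e.
  move=> /(filterI FP) /filter_ex[y [Py]] /=; rewrite norm_seminorm ltcR => zy.
  have -> : ip z x - Num.conj (g x) = ip (z - y) x + (ip y x - Num.conj (g x)).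
    by rewrite linearBl; ring.
  apply: le_trans (le_normcD _ _) _.
  have := cauchy_schwarz ip ip_ge0 (z - y) x; have := Py x.
  have := ler_wpM2r (seminorm_ge0 ip x) (ltW zy); rewrite -/N; lra.
have ipz : ip z x = Num.conj (g x).
  apply/eqP; rewrite -subr_eq0; apply/eqP/eq0_normc/eqP.
  rewrite eq_le normc_ge0 andbT leNgt; apply/negP => d0.
  (* If the modulus d is positive, [Nz] at e = d / (2 |x| + 1) gives d <= 2 e |x| < d; the added 1
     covers |x| = 0. *)
  have Nx1 : 0 < 2 * N x + 1 by rewrite ltr_wpDl// mulr_ge0 ?seminorm_ge0.
  have := Nz _ (divr_gt0 d0 Nx1); rewrite mulrAC mulrA ler_pdivlMr//; nra.
have -> : ip x z = Num.conj (ip z x) by exact: (formC ip ip_ge0).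
by rewrite ipz conjCK.
Qed.

(** By [riesz] for the functional x |-> <T x, y>, of bound M |y|, the [xget] in [adjoint] picks a
    genuine representing vector. *)
Lemma adjoint_spec (T : {linear H -> H}) x y : bounded_op T ->
  ip (T x) y = ip x (adjoint ip T y).
Proof.
move=> /bounded_op_seminorm[M M0 TM]; rewrite /adjoint.
case: xgetP => [_ _ /(_ x)//|noz]; exfalso.
have [u|z gz] := riesz (applyr ip y \o T) (M * N y); last exact: (noz z).
apply: le_trans (cauchy_schwarz ip ip_ge0 _ _) _.
by rewrite mulrAC ler_wpM2r ?seminorm_ge0.
Qed.

End Hilbert.

(** * The semi-inner product of [A] and [A]-adjoints *)

Section FormA.
Context {R : realType} {H : completeNormedModType R[i]}.
Variable ip : {dot H for (@Num.conj R[i])}.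
Variable A : {linear H -> H}.

Lemma ipA_bilinear : bilinear_for *%R (Num.conj \; *%R) (ipA ip A).
Proof.
split=> [y a u v|x a u v]; rewrite /ipA; last exact: linearPr.
by rewrite linearP linearDl linearZl_LR.
Qed.

HB.instance Definition _ :=
  bilinear_isBilinear.Build
  R[i] H H R[i] *%R (Num.conj \; *%R) (ipA ip A) ipA_bilinear.

End FormA.

Section AAdjoint.
Context {R : realType} {H : completeNormedModType R[i]}.
Variable ip : {dot H for (@Num.conj R[i])}.
Variable ipN : hilbert_norm ip.
Variable A : {linear H -> H}.
Variable A_ge0 : positive_op ip A.

Let N := normA ip A.

(** Positivity makes both [ip] and [ipA ip A] Hermitian, hence [A] selfadjoint. *)
Lemma ipA_sym x y : ipA ip A x y = ip x (A y).
Proof.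
rewrite (formC (ipA ip A) A_ge0 y x) /ipA.
exact/esym/(formC ip (ip_ge0 _ ipN)).
Qed.

Lemma in_BA_adjoint (T : {linear H -> H}) : in_BA ip A T ->
  exists2 S : {linear H -> H}, bounded_op S &
    forall x y, ipA ip A (T x) y = ipA ip A x (S y).
Proof.
move=> [Tb [S [Sb AS]]]; exists S => // x y.
by rewrite !ipA_sym adjoint_spec// AS.
Qed.

(** Cauchy-Schwarz gives <A x, x> <= M |x|^2, and M <= (M + 1)^2 avoids a square root in the
    constant. *)
Lemma normA_le_seminorm : bounded_op A ->
  exists2 K, 0 < K & forall x, N x <= K * seminorm ip x.
Proof.
move=> /(bounded_op_seminorm _ ipN)[M M0 AM]; exists (M + 1); first by rewrite addr_gt0.
move=> x; have q0 := seminorm_ge0 ip x.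
have N0 : 0 <= N x := seminorm_ge0 (ipA ip A) x.
rewrite -ler_sqr ?nnegrE// ?mulr_ge0 ?addr_ge0 ?(ltW M0)// exprMn.
have -> : N x ^+ 2 = normc (ip (A x) x).
  exact: (sqr_seminorm (ipA ip A) A_ge0).
apply: le_trans (cauchy_schwarz ip (ip_ge0 _ ipN) _ _) _.
apply: le_trans (ler_wpM2r q0 (AM x)) _.
rewrite -mulrA -expr2 ler_wpM2r ?sqr_ge0//; nra.
Qed.

Lemma A_adjoint_bounded (T S : {linear H -> H}) :
  bounded_op A -> bounded_op T -> bounded_op S ->
  (forall x y, ipA ip A (T x) y = ipA ip A x (S y)) ->
  exists M, forall x, N x = 1 -> N (T x) <= M.
Proof.
move=> /normA_le_seminorm[K K0 NK] /(bounded_op_seminorm _ ipN)[MT MT0 Tb].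
move=> /(bounded_op_seminorm _ ipN)[MS MS0 Sb] TS.
have ST x y : ipA ip A (S x) y = ipA ip A x (T y).
  have -> : ipA ip A (S x) y = Num.conj (ipA ip A y (S x)).
    exact: (formC (ipA ip A)).
  by rewrite -TS; exact/esym/(formC (ipA ip A)).
pose M := MS * MT; have M0 : 0 < M by rewrite mulr_gt0.
(* |T x|_A^2 = f x (S (T x)) <= |S (T x)|_A <= M, whence |T x|_A <= M + 1. *)
exists (M + 1) => x Nx.
have iter_le n : seminorm ip (iter n (S \o T) x) <= M ^+ n * seminorm ip x.
  elim: n => [|n IH] /=; first by rewrite mul1r.
  apply: le_trans (Sb _) _; rewrite exprS -mulrA -[_ * (_ * _)]mulrA ler_pM2l//.
  by apply: le_trans (Tb _) _; rewrite ler_pM2l.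
have STx : N (S (T x)) <= M.
  (* The factor [K * seminorm ip x] may depend on [x], since it disappears from the bound. *)
  apply: (selfadjoint_seminorm_le (ipA ip A) A_ge0 (S \o T)
    (K * seminorm ip x)) => //.
    by move=> u v /=; rewrite ST TS.
  by move=> n; apply: le_trans (NK _) _; rewrite -mulrA ler_pM2l// [leRHS]mulrC iter_le.
have N0 : 0 <= N (T x) := seminorm_ge0 (ipA ip A) _.
have : N (T x) ^+ 2 <= M.
  have -> : N (T x) ^+ 2 = normc (ipA ip A (T x) (T x)).
    exact: (sqr_seminorm (ipA ip A) A_ge0).
  rewrite TS.
  apply: le_trans (cauchy_schwarz (ipA ip A) A_ge0 _ _) _.
  by rewrite -[seminorm _ x]/(N x) Nx mul1r.
nra.
Qed.

End AAdjoint.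

Theorem corollary2p16 (R : realType) (H : completeNormedModType R[i])
    (ip : {dot H for (@Num.conj R[i])}) (A T : {linear H -> H}) (alpha : R[i]) :
  hilbert_norm ip ->
  bounded_op A -> positive_op ip A -> (exists x : H, A x != 0) ->
  in_BA ip A T ->
  alpha != 0 ->
  numradA ip A T ^+ 2 <=
    (Num.max 1 (Normc.normc (1 - alpha)) * opnormA ip A T ^+ 2
       + numradA ip A (T \o T)) / Normc.normc alpha.
Proof.
move=> ipN Ab A_ge0 _ TA alpha0; have [S Sb TS] := in_BA_adjoint _ ipN _ A_ge0 _ TA.
have [M TM] := A_adjoint_bounded _ ipN _ A_ge0 _ _ Ab TA.1 Sb TS.
have alpha_gt0 : 0 < normc alpha.
  rewrite lt_def normc_ge0 andbT; apply: contra_neq alpha0; exact: eq0_normc.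
have [[x0 Nx0]|noN] := pselect (exists x, normA ip A x = 1); last first.
  (* Without unit vectors each supremum is over the empty set, where [sup] is 0 by default, and the
     claim reads 0 <= 0. *)
  have img0 (F : H -> R) : [set F x | x in [set x : H | normA ip A x = 1]]%classic = set0.
    apply/seteqP; split => // y [x /= Nx]; by case: noN; exists x.
  by rewrite /numradA /opnormA !img0 !sup0 expr0n mulr0 addr0 mul0r.
set f := ipA ip A; set N := normA ip A.
set op := opnormA ip A T; set m := Num.max _ _.
have m0 : 0 <= m by rewrite le_max ler01.
have N0 x : 0 <= N x := seminorm_ge0 f x.
have CS x y : normc (f x y) <= N x * N y := cauchy_schwarz f A_ge0 x y.
have le_op x : N x = 1 -> N (T x) <= op.
  by move=> Nx; apply: ub_le_sup; [exists M => _ [y /= /TM yM <-] | exists x].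
have op0 : 0 <= op by exact: le_trans (N0 (T x0)) (le_op _ Nx0).
have Top x : N (T x) <= op * N x.
  (* If |x|_A = 0, then |T x|_A^2 = |f x (S (T x))| = 0 by Cauchy-Schwarz; otherwise [x] is
     normalised. *)
  have [Nx|Nx] := eqVneq (N x) 0.
    rewrite Nx mulr0 -(@ler_sqr _ (N (T x))) ?nnegrE// expr0n.
    have -> : N (T x) ^+ 2 = normc (f (T x) (T x)) := sqr_seminorm f A_ge0 _.
    rewrite /f TS.
    by apply: le_trans (CS _ _) _; rewrite Nx mul0r.
  have Nx_gt0 : 0 < N x by rewrite lt_def Nx N0.
  have Nxi : normc ((N x)^-1)%:C = (N x)^-1 by rewrite normc_real ger0_norm ?invr_ge0.
  have := le_op (((N x)^-1)%:C *: x); rewrite linearZ_LR.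
  have -> : N (((N x)^-1)%:C *: x) = 1.
    by rewrite [LHS](seminormZ f A_ge0) Nxi mulVf.
  have -> : N (((N x)^-1)%:C *: T x) = (N x)^-1 * N (T x).
    by rewrite [LHS](seminormZ f A_ge0) Nxi.
  by move=> /(_ erefl); rewrite mulrC ler_pdivrMr.
have Sop x : N (S x) <= op * N x by exact: (adjoint_seminorm_le (ipA ip A) A_ge0 T).
have le_w2 x : N x = 1 -> normc (f (T (T x)) x) <= numradA ip A (T \o T).
  move=> Nx; apply: ub_le_sup; last by exists x.
  exists (op * op) => _ [y /= Ny <-]; apply: le_trans (CS _ _) _; rewrite (Ny : N y = 1) mulr1.
  by apply: le_trans (Top _) _; rewrite ler_wpM2l// le_op.
set rhs := (_ / _).
have key x : N x = 1 -> normc (f (T x) x) ^+ 2 <= rhs.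
  move=> Nx; rewrite /rhs ler_pdivlMr// mulrC.
  have : normc alpha * (normc (f (T x) x) * normc (f x (S x))) <=
      m * (N (T x) * N (S x)) + normc (f (T x) (S x)) := buzano f A_ge0 alpha x _ _ Nx.
  rewrite /f -!TS -expr2 => /le_trans; apply.
  apply: lerD (le_w2 _ Nx); rewrite ler_wpM2l//.
  rewrite expr2; apply: ler_pM; rewrite ?N0//; first exact: le_op.
  by have := Sop x; rewrite Nx mulr1.
have rhs0 : 0 <= rhs by exact: le_trans (sqr_ge0 _) (key _ Nx0).
have w0 : 0 <= numradA ip A T.
  apply: le_trans (normc_ge0 (f (T x0) x0)) _; apply: ub_le_sup; last by exists x0.
  by exists op => _ [y /= Ny <-]; apply: le_trans (CS _ _) _; rewrite (Ny : N y = 1) mulr1 le_op.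
(* The bound [key] concerns squares; comparing with [Num.sqrt rhs] lets it be used under the
   supremum. *)
rewrite -(sqr_sqrtr rhs0) ler_sqr ?nnegrE ?sqrtr_ge0//.
apply: sup_le_ub; first by exists (normc (f (T x0) x0)), x0.
move=> _ [x /= Nx <-]; rewrite -(ger0_norm (normc_ge0 _)) -sqrtr_sqr.
by rewrite ler_wsqrtr// key.
Qed.
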